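(* Let $m\le n$. The geodesic equation on $M_+(n,m)$ with respect to the Riemannian metric $\langle u,v\rangle_a=\operatorname{tr}(u(a^Ta)^{-1}v^T)\sqrt{\det(a^Ta)}$ is given by $$a_{tt} = a_t(a^Ta)^{-1}a_t^Ta + a_t(a^Ta)^{-1}a^Ta_t-a(a^Ta)^{-1}a_t^Ta_t+\tfrac12\operatorname{tr}\left(a_t(a^Ta)^{-1}a_t^T\right)a-\operatorname{tr}\left(a_t(a^Ta)^{-1}a^T\right)a_t .$$
   Context: $M_+(n,m)$ is the set of real $n\times m$ matrices of rank $m$, an open subset of the vector space of all real $n\times m$ matrices. Subscript $t$ denotes differentiation in $t$ along a curve $a(t)$ in $M_+(n,m)$. *)

(* Defs.v *)
From HB Require Import structures.
From mathcomp Require Import all_boot all_order all_algebra.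
From mathcomp Require Import all_classical all_reals all_analysis.

Set Implicit Arguments.
Unset Strict Implicit.
Unset Printing Implicit Defensive.

Import Order.TTheory GRing.Theory Num.Theory.
Import numFieldNormedType.Exports.

Local Open Scope classical_set_scope.
Local Open Scope ring_scope.

(* Riemannian geometry on an open subset U of a normed space V.  All tangent
   spaces are identified with V; a vector field is a map V -> V of which only
   the restriction to U matters, and a Riemannian metric is given by
   g x u v = <u, v>_x. *)
Section RiemannianGeometry.
Context {R : realType} {V : normedModType R}.
Implicit Types (U : set V) (g : V -> V -> V -> R) (Gamma : V -> V -> V -> V).

Definition bilinear_on U Gamma :=
  forall x, U x -> (forall u, linear (Gamma x u)) /\
                   (forall v, linear (Gamma x ^~ v)).

(* In the global chart U, an affine connection is determined by its
   Christoffel map Gamma: nabla_X Y = dY(X) + Gamma(X, Y). *)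
Definition nabla Gamma (X Y : V -> V) (x : V) : V :=
  'd Y x (X x) + Gamma x (X x) (Y x).

Definition lie_bracket (X Y : V -> V) (x : V) : V :=
  'd Y x (X x) - 'd X x (Y x).

Definition torsion_free U Gamma :=
  forall (X Y : V -> V) (x : V), U x ->
    differentiable X x -> differentiable Y x ->
    nabla Gamma X Y x - nabla Gamma Y X x = lie_bracket X Y x.

Definition metric_compatible U g Gamma :=
  forall (X Y Z : V -> V) (x : V), U x ->
    differentiable X x -> differentiable Y x -> differentiable Z x ->
    is_derive x (X x) (fun y => g y (Y y) (Z y))
      (g x (nabla Gamma X Y x) (Z x) + g x (Y x) (nabla Gamma X Z x)).

Definition levi_civita U g Gamma :=
  [/\ bilinear_on U Gamma, torsion_free U Gamma & metric_compatible U g Gamma].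

(* Covariant derivative at time t of the vector field W along the curve c. *)
Definition nabla_along Gamma (c W : R -> V) (t : R) : V :=
  derive1 W t + Gamma (c t) (derive1 c t) (W t).

(* Meant for curves c that are twice differentiable on J with values in U. *)
Definition geodesic U g (J : set R) (c : R -> V) :=
  exists2 Gamma, levi_civita U g Gamma &
    forall t, J t -> nabla_along Gamma c (derive1 c) t = 0.

End RiemannianGeometry.

Definition full_rank_mx (R : realType) (n m : nat) : set 'M[R]_(n, m) :=
  [set a | \rank a = m].

Arguments full_rank_mx R n m : clear implicits.

Definition full_rank_metric (R : realType) (n m : nat)
    (a u v : 'M[R]_(n, m)) : R :=
  \tr (u *m invmx (a^T *m a) *m v^T) * Num.sqrt (\det (a^T *m a)).

(* Main.v *)
Require Import Defs.
From HB Require Import structures.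
From mathcomp Require Import all_boot all_order all_algebra.
From mathcomp Require Import all_classical all_reals all_analysis.
From mathcomp Require Import perm ring lra.

Set Implicit Arguments.
Unset Strict Implicit.
Unset Printing Implicit Defensive.

Import Order.TTheory GRing.Theory Num.Theory.
Import numFieldNormedType.Exports.

Local Open Scope classical_set_scope.
Local Open Scope ring_scope.

(** Write [G = (x^T x)^-1].  A curve is a geodesic when its acceleration is
    [- Gamma x u u], with [Gamma] the Levi-Civita connection of the metric and
    [u] the velocity, so the theorem amounts to identifying [Gamma].  The
    candidate [full_rank_christoffel] is the polarisation of minus the
    right-hand side of the geodesic equation, so that with it [- Gamma x u u]
    is that right-hand side.

    It is torsion free because it is symmetric.  For metric compatibility one
    differentiates [tr (v G w^T) sqrt (det (x^T x))] along a curve with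
    [x' = u]: from [G' = - G (u^T x + x^T u) G] and Jacobi's formula
    [(sqrt (det (x^T x)))' = tr (u G x^T) sqrt (det (x^T x))], the part that
    comes from the base point is
    [tr (u G x^T) tr (v G w^T) - tr (v G (u^T x + x^T u) G w^T)], times
    [sqrt (det (x^T x))].  It must equal
    [tr (Gamma(u,v) G w^T) + tr (v G Gamma(u,w)^T)] times the same factor; this
    is an identity between traces ([full_rank_christoffel_compatible]) in which
    everything cancels through cyclicity and transposition.  Full rank makes
    [det (x^T x)] positive, so that the square root is differentiable.

    Conversely a geodesic is one for some Levi-Civita connection, and a
    nondegenerate symmetric metric has only one ([levi_civita_unique]), which
    is therefore the candidate.  Nondegeneracy holds because
    [tr (w G w^T)] is the squared Frobenius norm of [w G x^T]. *)

(** * Positivity of Gram determinants *)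

Section SumOfSquares.
Context {R : realDomainType}.

Lemma mxtrace_mul_trE m n (w : 'M[R]_(m, n)) :
  \tr (w *m w^T) = \sum_i \sum_j w i j ^+ 2.
Proof.
by apply: eq_bigr => i _; rewrite mxE; apply: eq_bigr => j _; rewrite mxE.
Qed.

Lemma mxtrace_mul_tr_ge0 m n (w : 'M[R]_(m, n)) : 0 <= \tr (w *m w^T).
Proof.
by rewrite mxtrace_mul_trE; do 2![apply: sumr_ge0 => ? _]; exact: sqr_ge0.
Qed.

Lemma mxtrace_mul_tr_eq0 m n (w : 'M[R]_(m, n)) : \tr (w *m w^T) = 0 -> w = 0.
Proof.
rewrite mxtrace_mul_trE => /psumr_eq0P w0; apply/matrixP => i j; rewrite mxE.
have rows_ge0 k : true -> 0 <= \sum_l w k l ^+ 2.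
  by move=> _; apply: sumr_ge0 => l _; exact: sqr_ge0.
have /psumr_eq0P wi0 := w0 rows_ge0 i isT.
by apply/eqP; rewrite -sqrf_eq0; apply/eqP/wi0 => // k _; exact: sqr_ge0.
Qed.

End SumOfSquares.

Section Gram.
Context {R : rcfType}.

(** Were the determinant nonpositive, the polynomial [det (t 1 + (1 - t) N)],
    equal to [det N] at 0 and to 1 at 1, would vanish on the unit interval;
    but a convex combination of two positive definite forms is nonsingular. *)
Lemma posdef_det_gt0 m (N : 'M[R]_m) :
  (forall v : 'rV_m, v != 0 -> 0 < \tr (v *m N *m v^T)) -> 0 < \det N.
Proof.
move=> Npos; rewrite ltNge; apply/negP => detN.
pose P : 'M[{poly R}]_m := 'X%:M + (1 - 'X) *: map_mx polyC N.
have PE t : (\det P).[t] = \det (t%:M + (1 - t) *: N).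
  rewrite -[LHS]/(horner_eval t _) -det_map_mx; congr (\det _).
  apply/matrixP => i j; rewrite !mxE /horner_eval.
  by rewrite /= /horner_eval hornerD hornerMn hornerX hornerM hornerC !hornerE.
have [|t /andP[t0 t1] /rootP] := @poly_ivt _ (\det P) 0 1 ler01.
  by rewrite !PE subr0 subrr scale1r scale0r raddf0 add0r addr0 det1 detN ler01.
rewrite PE => /eqP/det0P[v v0 vP].
have : \tr (v *m (t%:M + (1 - t) *: N) *m v^T) = 0.
  by rewrite vP mul0mx raddf0.
rewrite mulmxDr mulmxDl mxtraceD mul_mx_scalar -scalemxAr -!scalemxAl !mxtraceZ.
have v2 : 0 < \tr (v *m v^T).
  rewrite lt_neqAle mxtrace_mul_tr_ge0 andbT eq_sym.
  by apply: contra v0 => /eqP/mxtrace_mul_tr_eq0 ->.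
have := Npos _ v0; nra.
Qed.

Lemma gram_det_gt0 n m (x : 'M[R]_(n, m)) :
  \rank x = m -> 0 < \det (x^T *m x).
Proof.
move=> rx; apply: posdef_det_gt0 => v v0.
have -> : v *m (x^T *m x) *m v^T = (v *m x^T) *m (v *m x^T)^T.
  by rewrite trmx_mul trmxK !mulmxA.
rewrite lt_neqAle mxtrace_mul_tr_ge0 andbT eq_sym; apply: contra v0.
move=> /eqP/mxtrace_mul_tr_eq0/eqP; rewrite mulmx_free_eq0 //.
by rewrite /row_free mxrank_tr rx.
Qed.

Lemma gram_unitmx n m (x : 'M[R]_(n, m)) :
  \rank x = m -> x^T *m x \in unitmx.
Proof. by move=> rx; rewrite unitmxE unitfE gt_eqF // gram_det_gt0. Qed.

Lemma trmx_invmx_gram n m (x : 'M[R]_(n, m)) :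
  (invmx (x^T *m x))^T = invmx (x^T *m x).
Proof. by rewrite trmx_inv trmx_mul trmxK. Qed.

End Gram.

(** * Derivatives of matrix operations *)

Section MatrixCalculus.
Context {R : realType}.

(** Reduces a directional derivative to the derivative of a curve, where
    differentiability gives continuity: a directional derivative alone does
    not keep an invertible matrix invertible in a neighbourhood. *)
Lemma is_derive_line {V W : normedModType R} (f : V -> W) x v df :
  is_derive x v f df <-> is_derive (0 : R) 1 (fun h => f (h *: v + x)) df.
Proof.
have E : 'D_v f x = 'D_1 (fun h : R => f (h *: v + x)) 0.
  rewrite /derive; set g1 := fun h => h^-1 *: _; set g2 := fun h => h^-1 *: _.
  suff -> : g1 = g2 by [].
  by apply/funext => h; rewrite /g1 /g2 /= addr0 scale0r add0r [_%:A]mulr1.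
split=> -[fx <-].
  by split; [exact: (derivable1P f x v).1 fx|rewrite E].
by split; [exact: (derivable1P f x v).2 fx|rewrite E].
Qed.

Context {V : normedModType R}.

Lemma is_derive_mxP m n (M : V -> 'M[R]_(m, n)) x v dM :
  is_derive x v M dM <-> forall i j, is_derive x v (fun y => M y i j) (dM i j).
Proof.
split=> [[Mx <-] i j|Mx].
  by rewrite derive_mx // mxE; apply/derivableP; exact: (derivable_mxP _ _ _).1.
have dMx : derivable M x v by apply/derivable_mxP => i j; have [] := Mx i j.
apply: DeriveDef => //; rewrite derive_mx //; apply/matrixP => i j.
by rewrite mxE; have [] := Mx i j.
Qed.

Lemma is_derive_bigsum (I : finType) (P : pred I) (h : I -> V -> R) (dh : I -> R)
    (x v : V) : (forall i, is_derive x v (h i) (dh i)) ->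
  is_derive x v (fun y => \sum_(i | P i) h i y) (\sum_(i | P i) dh i).
Proof.
move=> hx; have -> : (fun y => \sum_(i | P i) h i y) = \sum_(i | P i) h i.
  by apply/funext => y; rewrite fct_sumE.
by elim/big_ind2 : _ => // [|] *; [exact: is_derive_cst|exact: is_deriveD].
Qed.

Lemma is_derive_mul (f g : V -> R) (df dg : R) (x v : V) :
  is_derive x v f df -> is_derive x v g dg ->
  is_derive x v (fun y => f y * g y) (df * g x + f x * dg).
Proof.
by move=> fx gx; apply: (is_derive_eq (is_deriveM fx gx)); rewrite addrC mulrC.
Qed.

Lemma is_derive_bigprod n (h : 'I_n -> V -> R) (dh : 'I_n -> R) (x v : V) :
  (forall i, is_derive x v (h i) (dh i)) ->
  is_derive x v (fun y => \prod_i h i y)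
    (\sum_i dh i * \prod_(j | i != j) h j x).
Proof.
elim: n h dh => [|n IHn] h dh hx.
  under eq_fun do rewrite big_ord0.
  by rewrite big_ord0; exact: is_derive_cst.
under eq_fun do rewrite big_ord_recl.
have Dtail := IHn _ _ (fun i => hx (lift ord0 i)).
apply: (is_derive_eq (is_derive_mul (hx ord0) Dtail)).
rewrite [RHS]big_ord_recl; congr (_ * _ + _).
  by rewrite [RHS]big_mkcond big_ord_recl /= mul1r.
rewrite mulr_sumr; apply: eq_bigr => i _.
rewrite mulrCA; congr (_ * _).
rewrite [RHS]big_mkcond big_ord_recl /=; congr (_ * _).
by rewrite big_mkcond; apply: eq_bigr => j _; rewrite (inj_eq lift_inj).
Qed.

(** Jacobi's formula.  The product rule in the Leibniz expansion differentiates
    one row [i] at a time; grouping the permutations by the value [s i] turns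
    the remaining products into cofactors. *)
Lemma is_derive_det m (A : V -> 'M[R]_m) dA x v :
  is_derive x v A dA ->
  is_derive x v (fun y => \det (A y)) (\tr (\adj (A x) *m dA)).
Proof.
move=> /is_derive_mxP Ax.
have -> : \tr (\adj (A x) *m dA) = \sum_(s : 'S_m)
    (-1) ^+ s * \sum_i dA i (s i) * \prod_(j | i != j) A x j (s j).
  rewrite mxtrace_mulC; under [RHS]eq_bigr do rewrite mulr_sumr.
  rewrite exchange_big; apply: eq_bigr => i _.
  rewrite mxE (partition_big (fun s : 'S_m => s i) xpredT) //=.
  apply: eq_bigr => j _; rewrite mxE expand_cofactor mulr_sumr.
  by apply: eq_bigr => s /eqP <-; rewrite mulrCA.
apply: is_derive_bigsum => s.
have H := is_derive_bigprod (fun i => Ax i (s i)).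
by apply: (is_derive_eq (is_deriveZ _ H)).
Qed.

Lemma is_derive_trmx m n (A : V -> 'M[R]_(m, n)) dA x v :
  is_derive x v A dA -> is_derive x v (fun y => (A y)^T) dA^T.
Proof.
move=> /is_derive_mxP Ax; apply/is_derive_mxP => i j.
by under eq_fun do rewrite mxE; rewrite mxE.
Qed.

Lemma is_derive_mulmx m n p (A : V -> 'M[R]_(m, n)) (B : V -> 'M[R]_(n, p))
    dA dB x v :
  is_derive x v A dA -> is_derive x v B dB ->
  is_derive x v (fun y => A y *m B y) (dA *m B x + A x *m dB).
Proof.
move=> /is_derive_mxP Ax /is_derive_mxP Bx; apply/is_derive_mxP => i j.
under eq_fun do rewrite mxE.
rewrite !mxE -big_split /=.
by apply: is_derive_bigsum => k; exact: is_derive_mul.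
Qed.

Lemma is_derive_mxtrace m (A : V -> 'M[R]_m) dA x v :
  is_derive x v A dA -> is_derive x v (fun y => \tr (A y)) (\tr dA).
Proof.
by move=> /is_derive_mxP Ax; apply: is_derive_bigsum => i; exact: Ax.
Qed.

End MatrixCalculus.

Section Inverse.
Context {R : realType} {m : nat}.
Implicit Types A : R -> 'M[R]_m.

Lemma near_unitmx A t : derivable A t 1 -> A t \in unitmx ->
  \forall s \near t, A s \in unitmx.
Proof.
move=> /derivableP/is_derive_det[/derivable1_diffP/differentiable_continuous dc _].
rewrite unitmxE unitfE => d0; near=> s; rewrite unitmxE unitfE.
near: s; apply: (dc [set r | r != 0]).
exact: (open_nbhs_nbhs (conj (@open_neq R 0) d0)).
Unshelve. all: by end_near. Qed.

(** Cramer's rule is valid only where the matrix is invertible, hence the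
    passage to a neighbourhood of [t]. *)
Lemma derivable_invmx A t : derivable A t 1 -> A t \in unitmx ->
  derivable (fun s => invmx (A s)) t 1.
Proof.
move=> At uA; apply/derivable_mxP => i j.
apply: (@near_eq_derivable _ _ _
  (fun s => (\det (A s))^-1 * cofactor (A s) j i)).
  near=> s.
  have us : A s \in unitmx by near: s; exact: near_unitmx.
  by rewrite /invmx us !mxE.
apply: derivableM.
  apply: derivableV; last by have [] := is_derive_det (derivableP At).
  by rewrite -unitfE -unitmxE.
have /is_derive_mxP As := derivableP At.
have Dminor : is_derive t 1 (fun s => row' j (col' i (A s)))
    (row' j (col' i ('D_1 A t))).
  apply/is_derive_mxP => k l; rewrite !mxE.
  by under eq_fun do rewrite !mxE; exact: As.
by apply: derivableZ; have [] := is_derive_det Dminor.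
Unshelve. all: by end_near. Qed.

(** Once the inverse is known to be derivable, differentiating
    [invmx (A s) *m A s = 1], valid near [t], determines its derivative. *)
Lemma is_derive_invmx A dA (t : R) : is_derive t 1 A dA -> A t \in unitmx ->
  is_derive t 1 (fun s => invmx (A s)) (- (invmx (A t) *m dA *m invmx (A t))).
Proof.
move=> DA uA; have dA' : derivable A t 1 by case: DA.
have DG := derivableP (derivable_invmx dA' uA).
apply: (is_derive_eq DG); set G := fun s => invmx (A s) in DG *.
have [_ E1] := is_derive_mulmx DG DA.
have E2 : 'D_1 (fun s => G s *m A s) t = 0.
  rewrite -(derive_cst (1%:M : 'M[R]_m) t 1); apply: near_eq_derive; near=> s.
  by rewrite /G mulVmx //; near: s; exact: near_unitmx.
have : 'D_1 G t *m A t = - (G t *m dA).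
  by apply/eqP; rewrite -addr_eq0 -E1 E2.
by move=> /(congr1 (mulmx ^~ (invmx (A t)))); rewrite mulmxK // mulNmx.
Unshelve. all: by end_near. Qed.

Lemma is_derive_sqrt_det A dA (t : R) : is_derive t 1 A dA -> 0 < \det (A t) ->
  is_derive t 1 (fun s => Num.sqrt (\det (A s)))
    (2^-1 * \tr (invmx (A t) *m dA) * Num.sqrt (\det (A t))).
Proof.
move=> DA d0.
apply: (is_derive_eq (is_derive1_comp (is_derive1_sqrt d0) (is_derive_det DA))).
have uA : A t \in unitmx by rewrite unitmxE unitfE gt_eqF.
have -> : \adj (A t) = \det (A t) *: invmx (A t).
  by rewrite /invmx uA scalerA divff ?scale1r // gt_eqF.
rewrite -scalemxAl mxtraceZ -{2}(sqr_sqrtr (ltW d0)).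
have := d0; rewrite -sqrtr_gt0 => /lt0r_neq0 s0.
by field.
Qed.

End Inverse.

(** * Uniqueness of the Levi-Civita connection *)

Section KoszulUniqueness.
Context {R : realType} {V : normedModType R}.

(** Constant fields have no derivative and vanishing brackets, so testing the
    axioms of a connection on them isolates the Christoffel map. *)
Lemma nabla_cst (Gamma : V -> V -> V -> V) (u v x : V) :
  nabla Gamma (cst u) (cst v) x = Gamma x u v.
Proof. by rewrite /nabla diff_cst add0r. Qed.

Lemma torsion_free_sym (U : set V) (Gamma : V -> V -> V -> V) x u v :
  torsion_free U Gamma -> U x -> Gamma x u v = Gamma x v u.
Proof.
move=> tf Ux.
have := tf (cst u) (cst v) x Ux (differentiable_cst _ _) (differentiable_cst _ _).
rewrite !nabla_cst /lie_bracket !diff_cst subrr => /eqP.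
by rewrite subr_eq0 => /eqP.
Qed.

Lemma metric_compatible_cst (U : set V) (g : V -> V -> V -> R) Gamma x u v w :
  metric_compatible U g Gamma -> U x ->
  'D_u (fun y => g y v w) x = g x (Gamma x u v) w + g x v (Gamma x u w).
Proof.
move=> mc Ux.
have [_] := mc (cst u) (cst v) (cst w) x Ux (differentiable_cst _ _)
  (differentiable_cst _ _) (differentiable_cst _ _).
by rewrite !nabla_cst.
Qed.

(** The difference of two such connections gives [T p q r], symmetric in its
    first two arguments (no torsion) and antisymmetric in the last two (metric
    compatibility).  Such a [T] vanishes, and nondegeneracy concludes. *)
Lemma levi_civita_unique (U : set V) (g : V -> V -> V -> R) Gamma1 Gamma2 x u v :
  U x ->
  (forall w1 w2 w, g x (w1 - w2) w = g x w1 w - g x w2 w) ->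
  (forall w1 w2, g x w1 w2 = g x w2 w1) ->
  (forall w, g x w w = 0 -> w = 0) ->
  levi_civita U g Gamma1 -> levi_civita U g Gamma2 ->
  Gamma1 x u v = Gamma2 x u v.
Proof.
move=> Ux gB gC g0 [_ t1 c1] [_ t2 c2].
pose T p q r := g x (Gamma1 x p q - Gamma2 x p q) r.
have Tsym p q r : T p q r = T q p r.
  by rewrite /T (torsion_free_sym p q t1 Ux) (torsion_free_sym p q t2 Ux).
have Tanti p q r : T p q r = - T p r q.
  have := metric_compatible_cst p q r c1 Ux.
  rewrite (metric_compatible_cst p q r c2 Ux) /T !gB.
  rewrite !(gC q); lra.
apply/eqP; rewrite -subr_eq0; apply/eqP/g0.
(* Six exchanges of neighbouring arguments, alternately by the two symmetries,
   lead from T u v w to its opposite. *)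
set w := (X in g x _ X); change (T u v w = 0).
have := Tanti u v w; have := Tanti w u v; have := Tanti v w u.
rewrite (Tsym w v) (Tsym v u) (Tsym w u); lra.
Qed.

End KoszulUniqueness.

(** * The Levi-Civita connection of the metric on full rank matrices *)

Section Connection.
Context {R : realType} {n m : nat}.
Implicit Types x u v w : 'M[R]_(n, m).

(** Minus the polarisation in [u = v] of the right-hand side of the geodesic
    equation. *)
Definition full_rank_christoffel x u v : 'M[R]_(n, m) :=
  let G := invmx (x^T *m x) in
  - 2^-1 *: (u *m G *m v^T *m x + v *m G *m u^T *m x
             + u *m G *m x^T *m v + v *m G *m x^T *m u
             - x *m G *m u^T *m v - x *m G *m v^T *m u
             + \tr (u *m G *m v^T) *: x
             - \tr (u *m G *m x^T) *: v - \tr (v *m G *m x^T) *: u).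

Lemma mxtrace_symform (G : 'M[R]_m) u v : G^T = G ->
  \tr (u *m G *m v^T) = \tr (v *m G *m u^T).
Proof. by move=> GT; rewrite -mxtrace_tr !trmx_mul trmxK GT mulmxA. Qed.

Lemma full_rank_christoffelC x u v :
  full_rank_christoffel x u v = full_rank_christoffel x v u.
Proof.
rewrite /full_rank_christoffel /= (mxtrace_symform u v (trmx_invmx_gram x)).
congr (_ *: _); set G := invmx _.
by apply/matrixP => i j; rewrite !mxE; ring.
Qed.

Lemma full_rank_christoffel_linear x u : linear (full_rank_christoffel x u).
Proof.
move=> k v w; rewrite /full_rank_christoffel /=; set G := invmx _.
have -> : (k *: v + w)^T = k *: v^T + w^T by rewrite linearP.
rewrite !(mulmxDl, mulmxDr) -!(scalemxAl, scalemxAr, mxtraceD, mxtraceZ).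
rewrite !(mxtraceD, mxtraceZ).
by apply/matrixP => i j; rewrite !mxE; ring.
Qed.

(** The right-hand side is the derivative of [tr (v G w^T) sqrt (det (x^T x))]
    in the base point [x] along [u], with [v] and [w] held fixed, divided by the
    square root. *)
Lemma full_rank_christoffel_compatible x u v w :
  let G := invmx (x^T *m x) in let B := full_rank_christoffel x in
  \tr (B u v *m G *m w^T) + \tr (v *m G *m (B u w)^T) =
  \tr (u *m G *m x^T) * \tr (v *m G *m w^T)
  - \tr (v *m G *m (u^T *m x + x^T *m u) *m G *m w^T).
Proof.
move=> G B; have GT : G^T = G := trmx_invmx_gram x.
(* Every quartic trace that occurs has this shape; the two symmetries below
   reduce them to few enough for ring arithmetic to finish. *)
pose q (a b c d : 'M[R]_(n, m)) := \tr (a *m G *m b^T *m c *m G *m d^T).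
have qC a b c d : q a b c d = q c d a b.
  by rewrite /q -(mulmxA _ c G) -(mulmxA _ (c *m G)) mxtrace_mulC !mulmxA.
have qT a b c d : q a b c d = q d c b a.
  by rewrite /q -mxtrace_tr !trmx_mul !trmxK GT !mulmxA.
have trB p r s : \tr (B p r *m G *m s^T) = - 2^-1 *
  (q p r x s + q r p x s + q p x r s + q r x p s - q x p r s - q x r p s
   + \tr (p *m G *m r^T) * \tr (x *m G *m s^T)
   - \tr (p *m G *m x^T) * \tr (r *m G *m s^T)
   - \tr (r *m G *m x^T) * \tr (p *m G *m s^T)).
  have trN (A : 'M[R]_n) : \tr (- A) = - \tr A by rewrite raddfN.
  rewrite /B /full_rank_christoffel /= -/G -!scalemxAl !mxtraceZ.
  by rewrite !(mulmxDl, mulNmx, mxtraceD, trN) -!scalemxAl !mxtraceZ.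
rewrite (mxtrace_symform v (B u w) GT) !trB.
rewrite mulmxDr !mulmxDl mxtraceD !mulmxA -/(q v u x w) -/(q v x u w).
rewrite (mxtrace_symform x w GT) (mxtrace_symform x v GT) (mxtrace_symform w v GT).
rewrite (qC x w u v) (qC x v u w) (qT x u v w) (qC w v u x).
rewrite (qT x u w v) (qC v w u x) (qT w u x v) (qT w x u v).
by field.
Qed.

Lemma is_derive_full_rank_metric (c v w : R -> 'M[R]_(n, m)) (t : R) dc dv dw :
  \rank (c t) = m ->
  is_derive t 1 c dc -> is_derive t 1 v dv -> is_derive t 1 w dw ->
  is_derive t 1 (fun s => full_rank_metric (c s) (v s) (w s))
    (full_rank_metric (c t) (dv + full_rank_christoffel (c t) dc (v t)) (w t)
     + full_rank_metric (c t) (v t) (dw + full_rank_christoffel (c t) dc (w t))).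
Proof.
move=> rc Dc Dv Dw; have uN := gram_unitmx rc.
have DN := is_derive_mulmx (is_derive_trmx Dc) Dc.
have DG := is_derive_invmx DN uN.
have Dtr := is_derive_mxtrace
  (is_derive_mulmx (is_derive_mulmx Dv DG) (is_derive_trmx Dw)).
have Ds := is_derive_sqrt_det DN (gram_det_gt0 rc).
apply: (is_derive_eq (is_derive_mul Dtr Ds)); rewrite /full_rank_metric.
have := full_rank_christoffel_compatible (c t) dc (v t) (w t).
have GT := trmx_invmx_gram (c t); cbv zeta.
set G := invmx _ in GT *; set B := full_rank_christoffel _; set x := c t => compat.
(* The derivative of the Gram matrix of c at t. *)
set dN := _^T *m _ + _ in compat *.
have trG : \tr (G *m dN) = 2 * \tr (dc *m G *m x^T).
  rewrite /dN mulmxDr mxtraceD mulmxA mxtrace_mulC mulmxA.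
  rewrite (mxtrace_symform x dc GT).
  by rewrite mulmxA [X in _ + X]mxtrace_mulC mulmxA mulrDl mul1r.
clearbody dN.
have trN (A : 'M[R]_n) : \tr (- A) = - \tr A by rewrite raddfN.
have trmxD' (A A' : 'M[R]_(n, m)) : (A + A')^T = A^T + A'^T by rewrite raddfD.
rewrite trG trmxD' !(mulmxDl, mulmxDr, mxtraceD) mulmxN mulNmx trN !mulmxA.
by rewrite -[RHS]mulrDl addrACA compat; field.
Qed.

Lemma full_rank_metric_nondegenerate x w :
  \rank x = m -> full_rank_metric x w w = 0 -> w = 0.
Proof.
move=> rx /eqP; have uN := gram_unitmx rx; have GT := trmx_invmx_gram x.
rewrite mulf_eq0 [Num.sqrt _ == 0]gt_eqF ?sqrtr_gt0 ?gram_det_gt0 // orbF => /eqP.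
set G := invmx _ in GT *.
have -> : w *m G *m w^T = (w *m G *m x^T) *m (w *m G *m x^T)^T.
  by rewrite !trmx_mul trmxK GT -!mulmxA [x^T *m _]mulmxA mulKmx.
move=> /mxtrace_mul_tr_eq0 /(congr1 (mulmx ^~ x)).
by rewrite mul0mx -mulmxA mulmxKV.
Qed.

(** Compatibility along [X] at [x] is the product rule for the curve
    [h *: X x + x], with the fields [Y] and [Z] restricted to it. *)
Lemma full_rank_levi_civita :
  levi_civita (full_rank_mx R n m) (@full_rank_metric R n m)
    full_rank_christoffel.
Proof.
split=> [x _|X Y x Ux dX dY|X Y Z x Ux dX dY dZ].
- split=> u; first exact: full_rank_christoffel_linear.
  move=> k v w; rewrite !(full_rank_christoffelC _ _ u).
  exact: full_rank_christoffel_linear.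
- rewrite /nabla (full_rank_christoffelC x (X x)) /lie_bracket.
  by rewrite opprD addrACA subrr addr0.
- apply: (is_derive_line _ _ _ _).2.
  have D (F : 'M[R]_(n, m) -> 'M[R]_(n, m)) : differentiable F x ->
      is_derive (0 : R) 1 (fun h => F (h *: X x + x)) ('d F x (X x)).
    move=> dF; apply: (is_derive_line F x (X x) _).1.
    by rewrite -deriveE //; apply: derivableP; exact: diff_derivable.
  have Dx : is_derive (0 : R) 1 (fun h => h *: X x + x) (X x).
    by apply: (is_derive_line id x (X x) _).1; exact: is_derive_id.
  have := is_derive_full_rank_metric _ Dx (D _ dY) (D _ dZ).
  by rewrite /nabla scale0r add0r; apply.
Qed.

End Connection.

Theorem theorem3p4 (R : realType) (n m : nat) (hmn : (m <= n)%N)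
    (J : set R) (hJ : open J) (hJi : is_interval J)
    (a : R -> 'M[R]_(n, m))
    (ha : forall t, J t -> full_rank_mx R n m (a t))
    (ha1 : forall t, J t -> derivable a t 1)
    (ha2 : forall t, J t -> derivable (derive1 a) t 1) :
  geodesic (full_rank_mx R n m) (@full_rank_metric R n m) J a <->
  forall t, J t ->
    let x := a t in
    let u := derive1 a t in
    let G := invmx (x^T *m x) in
    derive1 (derive1 a) t =
      u *m G *m u^T *m x + u *m G *m x^T *m u - x *m G *m u^T *m u
      + (2^-1 * \tr (u *m G *m u^T)) *: x
      - \tr (u *m G *m x^T) *: u.
Proof.
have christoffel_diag (x u : 'M[R]_(n, m)) : let G := invmx (x^T *m x) in
    - full_rank_christoffel x u u =
      u *m G *m u^T *m x + u *m G *m x^T *m u - x *m G *m u^T *m u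
      + (2^-1 * \tr (u *m G *m u^T)) *: x - \tr (u *m G *m x^T) *: u.
  rewrite /full_rank_christoffel /=; set G := invmx _.
  by apply/matrixP => i j; rewrite !mxE; field.
split=> [[Gamma LC geo] t Jt /=|eq_a].
  rewrite -christoffel_diag; apply/eqP; rewrite -addr_eq0; apply/eqP.
  rewrite -[RHS](geo t Jt); congr (_ + _).
  apply: (levi_civita_unique _ _ (ha t Jt) _ _ _ full_rank_levi_civita LC).
  - by move=> w1 w2 w; rewrite /full_rank_metric !mulmxBl raddfB mulrBl.
  - move=> w1 w2; congr (_ * _).
    exact: (mxtrace_symform _ _ (trmx_invmx_gram _)).
  - by move=> w; apply: full_rank_metric_nondegenerate; exact: ha.
exists full_rank_christoffel; first exact: full_rank_levi_civita.
move=> t Jt; rewrite /nabla_along eq_a //.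
by rewrite -christoffel_diag addNr.
Qed.
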